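(* Let $(M,J,g)$ be a $(J^{2}=\pm1)$-metric manifold, with $J^{2}=\alpha\,Id$, and let $\nabla$ be a metric connection, i.e. a linear connection on $M$ with $\nabla g=0$. Then $\pi(\nabla)$ is also a metric connection, where $$(\pi(\nabla))_X Y=\frac12\nabla_X Y+\frac{\alpha}{2}J(\nabla_X(JY)),\quad\forall X,Y\in\mathfrak{X}(M).$$
   Context: All manifolds and operators are of class $C^{\infty}$; $\mathfrak{X}(M)$ is the module of vector fields on $M$. $(J^{2}=\pm1)$-metric manifold: a triple $(M,J,g)$ where $M$ is a manifold, $g$ is a semi-Riemannian metric on $M$, $J$ is a tensor field of type $(1,1)$, and for some $\alpha,\varepsilon\in\{-1,1\}$ one has $$J^{2}=\alpha\,Id,\quad \mathrm{trace}\,J=0,\quad g(JX,JY)=\varepsilon g(X,Y),\quad\forall X,Y\in\mathfrak{X}(M),$$ $g$ being a Riemannian metric if $\varepsilon=1$. The map $\pi=\frac12 Id+\frac12 J_{*}$ is the projection of the affine space $\mathcal{C}(M)$ of linear connections on $M$ onto the space $\mathcal{C}(M,J)$ of linear connections with $\nabla J=0$, where $J_{*}:\mathcal{C}(M)\to\mathcal{C}(M)$ is the canonical involution $(J_{*}(\nabla))_X(Y)=\alpha J(\nabla_X(JY))$. *)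

(* Defs.v *)
From HB Require Import structures.
From mathcomp Require Import all_boot all_order all_algebra.
From mathcomp Require Import boolp classical_sets functions reals topology.
From mathcomp Require Import normedtype derive.
Set Implicit Arguments.
Unset Strict Implicit.
Unset Printing Implicit Defensive.
Import Order.TTheory GRing.Theory Num.Theory.
Import numFieldNormedType.Exports.
Local Open Scope classical_set_scope.
Local Open Scope ring_scope.

Section SmoothOn.
Context {R : realType} {n : nat}.
Implicit Types (U : set 'rV[R]_n) (f g : 'rV[R]_n -> R^o).

(* Meant for [U] open: all iterated partial derivatives of order at most [k]
   exist and are continuous on [U]. *)
Fixpoint Ck_on (k : nat) U f : Prop :=
  (forall x, U x -> {for x, continuous f}) /\
  if k is k'.+1 then
    forall i : 'I_n, (forall x, U x -> derivable f x (delta_mx 0 i)) /\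
      Ck_on k' U (fun x => 'D_(delta_mx 0 i) f x)
  else True.

Definition smooth_on U f : Prop := forall k, Ck_on k U f.

Lemma Ck_on_continuous k U f : Ck_on k U f ->
  forall x, U x -> {for x, continuous f}.
Proof. by case: k => [|k] []. Qed.

Lemma Ck_onW k U f : Ck_on k.+1 U f -> Ck_on k U f.
Proof.
elim: k f => [|k IH] f [fc fd]; first by split.
by split=> // i; have [? ?] := fd i; split=> //; apply: IH.
Qed.

Lemma near_eq_on U f g x : open U -> (forall y, U y -> f y = g y) -> U x ->
  \forall y \near x, f y = g y.
Proof.
by move=> oU fg Ux; apply: filterS fg _; exact: open_nbhs_nbhs.
Qed.

Lemma continuous_eq_on U f g x : open U -> (forall y, U y -> f y = g y) ->
  U x -> {for x, continuous f} -> {for x, continuous g}.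
Proof.
move=> oU fg Ux fc; rewrite /prop_for /continuous_at -(fg x Ux).
by apply: cvg_trans fc; apply: (@near_eq_cvg _ _ (nbhs x)); exact: near_eq_on oU fg Ux.
Qed.

Lemma Ck_on_eq k U f g : open U -> (forall x, U x -> f x = g x) ->
  Ck_on k U f -> Ck_on k U g.
Proof.
move=> oU; elim: k f g => [|k IH] f g fg [fc fd].
  by split=> // x Ux; exact: continuous_eq_on fg Ux (fc x Ux).
split=> [x Ux|i]; first exact: continuous_eq_on fg Ux (fc x Ux).
have [fdi fk] := fd i; split=> [x Ux|].
  exact: near_eq_derivable (near_eq_on oU fg Ux) (fdi x Ux).
by apply: IH fk => x Ux; exact: near_eq_derive (near_eq_on oU fg Ux).
Qed.

Lemma Ck_on_cst k U (a : R) : Ck_on k U (fun=> a).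
Proof.
elim: k a => [|k IH] a; split=> //; try by move=> x _; exact: cst_continuous.
move=> i; split=> [x _|]; first exact: derivable_cst.
rewrite (_ : (fun x => 'D_(delta_mx 0 i) _ x) = (fun=> 0)) //.
by apply: funext => x; exact: derive_cst.
Qed.

Lemma Ck_onD k U f g : open U ->
  Ck_on k U f -> Ck_on k U g -> Ck_on k U (fun x => f x + g x).
Proof.
move=> oU; elim: k f g => [|k IH] f g [fc fd] [gc gd]; split=> //.
1,2: by move=> x Ux; apply: continuousD; [exact: fc|exact: gc].
move=> i; have [fi fk] := fd i; have [gi gk] := gd i; split=> [x Ux|].
  by apply: derivableD; [exact: fi|exact: gi].
apply: Ck_on_eq (IH _ _ fk gk) => // x Ux.
by rewrite -deriveD//; [exact: fi|exact: gi].
Qed.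

Lemma Ck_onM k U f g : open U ->
  Ck_on k U f -> Ck_on k U g -> Ck_on k U (fun x => f x * g x).
Proof.
move=> oU; elim: k f g => [|k IH] f g Hf Hg.
  split=> // x Ux; have [fc _] := Hf; have [gc _] := Hg.
  by apply: continuousM; [exact: fc|exact: gc].
have [fc fd] := Hf; have [gc gd] := Hg.
split=> [x Ux|i]; first by apply: continuousM; [exact: fc|exact: gc].
have [fi fk] := fd i; have [gi gk] := gd i; split=> [x Ux|].
  by apply: derivableM; [exact: fi|exact: gi].
apply: Ck_on_eq (Ck_onD oU (IH _ _ (Ck_onW Hf) gk) (IH _ _ (Ck_onW Hg) fk)) => //.
by move=> x Ux; exact: esym (deriveM (fi x Ux) (gi x Ux)).
Qed.

End SmoothOn.

Record chart (R : realType) (n : nat) (M : topologicalType) := Chart {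
  chart_dom : set M;
  chart_img : set 'rV[R]_n;
  chart_map :> M -> 'rV[R]_n;
  chart_inv : 'rV[R]_n -> M;
  open_chart_dom : open chart_dom;
  open_chart_img : open chart_img;
  chart_mapP : forall x, chart_dom x -> chart_img (chart_map x);
  chart_invP : forall y, chart_img y -> chart_dom (chart_inv y);
  chart_mapK : forall x, chart_dom x -> chart_inv (chart_map x) = x;
  chart_invK : forall y, chart_img y -> chart_map (chart_inv y) = y;
  chart_map_continuous : {within chart_dom, continuous chart_map};
  chart_inv_continuous : {within chart_img, continuous chart_inv} }.

Arguments open_chart_dom {R n M} c.
Arguments open_chart_img {R n M} c.

Definition smooth_compatible (R : realType) (n : nat) (M : topologicalType)
    (c d : chart R n M) : Prop :=
  forall i : 'I_n,
    smooth_on (chart_img c `&` chart_inv c @^-1` chart_dom d)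
              (fun y => d (chart_inv c y) 0 i).

(* The atlas need not be maximal: smoothness of functions depends only on the
   smooth structure that it generates. *)
Record manifold (R : realType) (n : nat) := Manifold {
  carrier :> topologicalType;
  atlas : set (chart R n carrier);
  manifold_hausdorff : hausdorff_space carrier;
  manifold_second_countable : @second_countable carrier;
  atlas_cover : forall x : carrier, exists2 c, atlas c & chart_dom c x;
  atlas_compatible : forall c d, atlas c -> atlas d -> smooth_compatible c d }.

Section SmoothFunctions.
Context {R : realType} {n : nat} (M : manifold R n).

Definition smooth_pred : pred (M -> R^o) := fun f =>
  `[< forall c, atlas c -> smooth_on (chart_img c) (f \o chart_inv c) >].

Lemma smooth_subring_closed : subring_closed smooth_pred.
Proof.
split=> [|f g /asboolP sf /asboolP sg|f g /asboolP sf /asboolP sg];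
  apply/asboolP => c Ac k; have oU := open_chart_img c.
- exact: Ck_on_cst.
- have := Ck_onD oU (sf c Ac k)
    (Ck_onM oU (Ck_on_cst k (chart_img c) (-1)) (sg c Ac k)).
  by apply: Ck_on_eq => // x _; rewrite mulN1r.
- exact: Ck_onM (sf c Ac k) (sg c Ac k).
Qed.

Lemma smooth_scaler_closed : GRing.scaler_closed smooth_pred.
Proof.
move=> a f /asboolP sf; apply/asboolP => c Ac k.
have oU := open_chart_img c.
exact: Ck_onM (Ck_on_cst k (chart_img c) a) (sf c Ac k).
Qed.

HB.instance Definition _ :=
  GRing.isSubringClosed.Build _ smooth_pred smooth_subring_closed.
HB.instance Definition _ :=
  GRing.isScaleClosed.Build _ _ smooth_pred smooth_scaler_closed.

(* C^oo(M) *)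
Record smooth_fun := SmoothFun {
  smooth_val :> M -> R^o;
  smooth_valP : smooth_val \in smooth_pred }.

HB.instance Definition _ := [isSub of smooth_fun for smooth_val].
HB.instance Definition _ := [Choice of smooth_fun by <:].
HB.instance Definition _ := GRing.SubChoice_isSubComPzRing.Build (M -> R^o)
  smooth_pred smooth_fun smooth_subring_closed.
HB.instance Definition _ := [SubZmodule_isSubLmodule of smooth_fun by <:].

Definition const_fun (a : R) : smooth_fun := a *: (1 : smooth_fun).

End SmoothFunctions.

Arguments smooth_pred {R n} M _.
Arguments const_fun {R n} M a.

Section Tangent.
Context {R : realType} {n : nat} (M : manifold R n).

Definition is_derivation (p : M) (v : smooth_fun M -> R^o) : Prop :=
  [/\ forall f g, v (f + g) = v f + v g,
      forall (a : R) f, v (a *: f) = a * v f &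
      forall f g, v (f * g) = f p * v g + g p * v f].

Definition derivation_pred (p : M) : pred (smooth_fun M -> R^o) :=
  fun v => `[< is_derivation p v >].

Lemma derivation_submod_closed p : submod_closed (derivation_pred p).
Proof.
split=> [|a u v /asboolP[uD uZ uM] /asboolP[vD vZ vM]]; apply/asboolP.
  split=> [f g|a f|f g]; rewrite /(GRing.zero _) /=.
  - by rewrite addr0.
  - by rewrite mulr0.
  - by rewrite !mulr0 addr0.
have E h : (a *: u + v) h = a * u h + v h by [].
split=> [f g|b f|f g]; rewrite !E.
- by rewrite uD vD mulrDr addrACA.
- by rewrite uZ vZ mulrDr mulrCA.
- by rewrite uM vM !mulrDr addrACA ![a * (_ * _)]mulrCA.
Qed.

HB.instance Definition _ p :=
  GRing.isSubmodClosed.Build _ _ (derivation_pred p) (derivation_submod_closed p).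

(* T_p M, as the space of derivations at p of C^oo(M) *)
Record tangent (p : M) := Tangent {
  tangent_val :> smooth_fun M -> R^o;
  tangent_valP : tangent_val \in derivation_pred p }.

HB.instance Definition _ p := [isSub of tangent p for @tangent_val p].
HB.instance Definition _ p := [Choice of tangent p by <:].
HB.instance Definition _ p := [SubChoice_isSubLmodule of tangent p by <:].

Definition smooth_section (X : forall p : M, tangent p) : Prop :=
  forall f : smooth_fun M, (fun p => X p f) \in smooth_pred M.

Record vector_field := VectorField {
  field_val :> forall p : M, tangent p;
  field_smooth : smooth_section field_val }.

HB.instance Definition _ := gen_eqMixin vector_field.
HB.instance Definition _ := gen_choiceMixin vector_field.

Lemma vector_fieldP (X Y : vector_field) : (forall p, X p = Y p) -> X = Y.
Proof.
case: X Y => [X sX] [Y sY] /= XY.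
have {}XY : X = Y by exact: functional_extensionality_dep.
by case: _ / XY sY => sY; congr VectorField; exact: Prop_irrelevance.
Qed.

Lemma field0_smooth : smooth_section (fun p => 0).
Proof. by move=> f; rewrite [X in X \in _](_ : _ = 0) ?rpred0. Qed.

Lemma fieldN_smooth (X : vector_field) : smooth_section (fun p => - X p).
Proof.
move=> f; rewrite [X in X \in _](_ : _ = - (fun p => X p f)) //.
by rewrite rpredN; exact: field_smooth.
Qed.

Lemma fieldD_smooth (X Y : vector_field) : smooth_section (fun p => X p + Y p).
Proof.
move=> f; rewrite [X in X \in _](_ : _ = (fun p => X p f) + (fun p => Y p f)) //.
by rewrite rpredD//; exact: field_smooth.
Qed.

Lemma fieldZ_smooth (h : smooth_fun M) (X : vector_field) :
  smooth_section (fun p => h p *: X p).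
Proof.
move=> f.
rewrite [X in X \in _](_ : _ = (h : M -> R^o) * (fun p => X p f)) //.
by rewrite rpredM//; [exact: smooth_valP|exact: field_smooth].
Qed.

Definition field0 := VectorField field0_smooth.
Definition fieldN X := VectorField (@fieldN_smooth X).
Definition fieldD X Y := VectorField (@fieldD_smooth X Y).
Definition fieldZ h X := VectorField (@fieldZ_smooth h X).

Lemma fieldDA : associative fieldD.
Proof. by move=> X Y Z; apply: vector_fieldP => p /=; rewrite addrA. Qed.
Lemma fieldDC : commutative fieldD.
Proof. by move=> X Y; apply: vector_fieldP => p /=; rewrite addrC. Qed.
Lemma field0D : left_id field0 fieldD.
Proof. by move=> X; apply: vector_fieldP => p /=; rewrite add0r. Qed.
Lemma fieldND : left_inverse field0 fieldN fieldD.
Proof. by move=> X; apply: vector_fieldP => p /=; rewrite addNr. Qed.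
HB.instance Definition _ :=
  GRing.isZmodule.Build vector_field fieldDA fieldDC field0D fieldND.

Lemma fieldZA f g X : fieldZ f (fieldZ g X) = fieldZ (f * g) X.
Proof. by apply: vector_fieldP => p /=; rewrite scalerA. Qed.
Lemma field1Z : left_id 1 fieldZ.
Proof. by move=> X; apply: vector_fieldP => p /=; rewrite scale1r. Qed.
Lemma fieldZDr : right_distributive fieldZ +%R.
Proof. by move=> f X Y; apply: vector_fieldP => p /=; rewrite scalerDr. Qed.
Lemma fieldZDl X : {morph fieldZ^~ X : f g / f + g}.
Proof. by move=> f g; apply: vector_fieldP => p /=; rewrite scalerDl. Qed.
(* the module of vector fields over C^oo(M) *)
HB.instance Definition _ := GRing.Zmodule_isLmodule.Build (smooth_fun M)
  vector_field fieldZA field1Z fieldZDr fieldZDl.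

(* the function X(f) *)
Definition field_der (X : vector_field) (f : smooth_fun M) : smooth_fun M :=
  SmoothFun (field_smooth X f).

Record tensor11 := Tensor11 {
  tensor11_at : forall p : M, {linear tangent p -> tangent p};
  tensor11_smooth : forall X : vector_field,
    smooth_section (fun p => tensor11_at p (X p)) }.

Definition tensor11_app (J : tensor11) (X : vector_field) : vector_field :=
  VectorField (tensor11_smooth J X).

Record tensor02 := Tensor02 {
  tensor02_at : forall p : M, {biscalar tangent p};
  tensor02_smooth : forall X Y : vector_field,
    (fun p => tensor02_at p (X p) (Y p)) \in smooth_pred M }.

Definition tensor02_app (g : tensor02) (X Y : vector_field) : smooth_fun M :=
  SmoothFun (tensor02_smooth g X Y).

End Tangent.

Coercion tensor11_app : tensor11 >-> Funclass.
Coercion tensor02_app : tensor02 >-> Funclass.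

Section LinearAlgebra.
Context {R : realType} {V : lmodType R}.

Definition is_basis (m : nat) (e : 'I_m -> V) : Prop :=
  (forall c : 'I_m -> R, \sum_i c i *: e i = 0 -> forall i, c i = 0) /\
  (forall v, exists c : 'I_m -> R, v = \sum_i c i *: e i).

(* [L] has trace [t], read off its matrix in a basis of [V]. *)
Definition has_trace (L : V -> V) (t : R) : Prop :=
  exists (m : nat) (e : 'I_m -> V) (A : 'M[R]_m),
    [/\ is_basis e, forall j, L (e j) = \sum_i A i j *: e i & \tr A = t].

(* The vectors [e i] are automatically linearly independent, and [b] is
   negative definite on their span. *)
Definition negative_family (b : V -> V -> R) (m : nat) (e : 'I_m -> V) : Prop :=
  forall c : 'I_m -> R, (exists i, c i != 0) ->
    b (\sum_i c i *: e i) (\sum_i c i *: e i) < 0.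

(* [nu] is the maximal dimension of a negative definite subspace. *)
Definition has_index (b : V -> V -> R) (nu : nat) : Prop :=
  (exists e : 'I_nu -> V, negative_family b e) /\
  (forall (m : nat) (e : 'I_m -> V), negative_family b e -> (m <= nu)%N).

End LinearAlgebra.

Section Connections.
Context {R : realType} {n : nat} {M : manifold R n}.
Implicit Types (J : tensor11 M) (g : tensor02 M).
Implicit Types (nabla : vector_field M -> vector_field M -> vector_field M).

Definition semi_riemannian_metric g : Prop :=
  [/\ forall p (u v : tangent p), tensor02_at g p u v = tensor02_at g p v u,
      forall p (u : tangent p),
        (forall v : tangent p, tensor02_at g p u v = 0) -> u = 0 &
      exists nu : nat, forall p, has_index (tensor02_at g p) nu].

Definition riemannian_metric g : Prop :=
  semi_riemannian_metric g /\
  forall p (u : tangent p), u != 0 -> 0 < tensor02_at g p u u.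

(* (J^2 = +-1)-metric manifold (M, J, g), for the given signs *)
Definition J2pm1_metric_manifold J g (alpha epsilon : R) : Prop :=
  [/\ (alpha = 1 \/ alpha = -1) /\ (epsilon = 1 \/ epsilon = -1),
      semi_riemannian_metric g /\ (epsilon = 1 -> riemannian_metric g),
      forall X, J (J X) = const_fun M alpha *: X,
      forall p, has_trace (tensor11_at J p) 0 &
      forall X Y, g (J X) (J Y) = epsilon *: g X Y].

Definition linear_connection nabla : Prop :=
  [/\ forall X X' Y : vector_field M,
        nabla (X + X') Y = nabla X Y + nabla X' Y,
      forall (f : smooth_fun M) (X Y : vector_field M),
        nabla (f *: X) Y = f *: nabla X Y,
      forall X Y Y' : vector_field M,
        nabla X (Y + Y') = nabla X Y + nabla X Y',
      forall (a : R) (X Y : vector_field M),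
        nabla X (const_fun M a *: Y) = const_fun M a *: nabla X Y &
      forall (f : smooth_fun M) (X Y : vector_field M),
        nabla X (f *: Y) = field_der X f *: Y + f *: nabla X Y].

(* (nabla_X g)(Y, Z) *)
Definition nabla_tensor02 nabla g (X Y Z : vector_field M) : smooth_fun M :=
  field_der X (g Y Z) - g (nabla X Y) Z - g Y (nabla X Z).

Definition metric_connection g nabla : Prop :=
  linear_connection nabla /\ forall X Y Z, nabla_tensor02 nabla g X Y Z = 0.

(* the canonical involution J_* *)
Definition J_star (alpha : R) J nabla : vector_field M -> vector_field M ->
    vector_field M :=
  fun X Y => const_fun M alpha *: J (nabla X (J Y)).

(* pi = Id/2 + J_*/2 *)
Definition pi_connection (alpha : R) J nabla : vector_field M ->
    vector_field M -> vector_field M :=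
  fun X Y => const_fun M (1 / 2) *: nabla X Y +
             const_fun M (1 / 2) *: J_star alpha J nabla X Y.

End Connections.

(* Main.v *)
(* [J_*] maps metric connections to metric connections: the isometry property
   and [J^2 = alpha Id] give [g(alpha J U, Z) = epsilon g(U, J Z)], so that
   [g((J_* nabla)_X Y, Z) + g(Y, (J_* nabla)_X Z)] equals
   [epsilon X(g(J Y, J Z)) = X(g(Y, Z))].  Metric connections form an affine
   space, hence the midpoint of [nabla] and [J_* nabla] is metric too. *)
Require Import Defs.
From mathcomp Require Import all_boot all_order all_algebra reals.
From mathcomp Require Import boolp topology ring.
Import GRing.Theory Num.Theory.
Local Open Scope ring_scope.

Section TensorCalculus.
Context {R : realType} {n : nat} {M : manifold R n}.
Implicit Types (f h : smooth_fun M) (a b : R) (X Y Z : vector_field M).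
Implicit Types (J : tensor11 M) (g : tensor02 M).

Lemma smooth_funP f h : (forall p, f p = h p) -> f = h.
Proof. by move=> fh; apply: val_inj; apply: funext. Qed.

Lemma smooth_funD f h p : (f + h) p = f p + h p. Proof. by []. Qed.
Lemma smooth_funN f p : (- f) p = - f p. Proof. by []. Qed.
Lemma smooth_funM f h p : (f * h) p = f p * h p. Proof. by []. Qed.

Lemma const_funE a (p : M) : const_fun M a p = a.
Proof. exact: mulr1. Qed.

Lemma const_funD a b : const_fun M (a + b) = const_fun M a + const_fun M b.
Proof. by apply: smooth_funP => p; rewrite smooth_funD !const_funE. Qed.

Lemma const_funM a b : const_fun M (a * b) = const_fun M a * const_fun M b.
Proof. by apply: smooth_funP => p; rewrite smooth_funM !const_funE. Qed.

Lemma const_fun1 : const_fun M 1 = 1.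
Proof. exact: scale1r. Qed.

Lemma smooth_fun_mulrC f h : f * h = h * f.
Proof. by apply: smooth_funP => p; rewrite !smooth_funM mulrC. Qed.

Lemma vector_field_scaleCA f h X : f *: (h *: X) = h *: (f *: X).
Proof. by rewrite !scalerA smooth_fun_mulrC. Qed.

Lemma tensor11D J X Y : J (X + Y) = J X + J Y.
Proof. by apply: vector_fieldP => p; exact: linearD. Qed.

(** A function acts on a field at [p] through the real number [f p], so fibrewise real linearity
    yields linearity over the ring of smooth functions; the same holds for [g] below. *)
Lemma tensor11Z J f X : J (f *: X) = f *: J X.
Proof. by apply: vector_fieldP => p; exact: linearZZ. Qed.

Lemma tensor02Dl g X Y Z : g (X + Y) Z = g X Z + g Y Z.
Proof. by apply: smooth_funP => p; exact: linearDl. Qed.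

Lemma tensor02Dr g X Y Z : g X (Y + Z) = g X Y + g X Z.
Proof. by apply: smooth_funP => p; exact: linearDr. Qed.

Lemma tensor02Zl g f X Y : g (f *: X) Y = f * g X Y.
Proof. by apply: smooth_funP => p; exact: linearZl_LR. Qed.

Lemma tensor02Zr g f X Y : g X (f *: Y) = f * g X Y.
Proof. by apply: smooth_funP => p; exact: linearZr_LR. Qed.

(** Here [a] is a real number, so no product-rule term appears; this lets the sign [epsilon] leave a
    derivative. *)
Lemma field_derZ X a f : field_der X (a *: f) = a *: field_der X f.
Proof.
apply: smooth_funP => p.
by have /asboolP[_ vZ _] := tangent_valP (X p); exact: vZ.
Qed.

End TensorCalculus.

Section Midpoint.
Context {R : realType} {n : nat} {M : manifold R n}.
Implicit Types (nabla D : vector_field M -> vector_field M -> vector_field M).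

(** For [D := J_star alpha J nabla] this unfolds to [pi_connection], so facts about midpoints apply
    to it by conversion. *)
Definition midpoint_connection nabla D : vector_field M -> vector_field M ->
    vector_field M :=
  fun X Y => const_fun M (1 / 2) *: nabla X Y + const_fun M (1 / 2) *: D X Y.

Lemma const_fun_halves : const_fun M (1 / 2) + const_fun M (1 / 2) = 1.
Proof. by rewrite -const_funD -const_fun1; congr const_fun; field. Qed.

Lemma linear_connection_midpoint nabla D :
  linear_connection nabla -> linear_connection D ->
  linear_connection (midpoint_connection nabla D).
Proof.
move=> [nDl nZl nDr nZr nL] [dDl dZl dDr dZr dL].
rewrite /midpoint_connection; split=> [X X' Y|f X Y|X Y Y'|a X Y|f X Y].
- by rewrite nDl dDl !scalerDr addrACA.
- by rewrite nZl dZl scalerDr !(vector_field_scaleCA f).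
- by rewrite nDr dDr !scalerDr addrACA.
- by rewrite nZr dZr scalerDr !(vector_field_scaleCA (const_fun M a)).
(* The Leibniz rule is the one axiom that is affine rather than linear in the connection: the two
   terms [field_der X f *: Y] merge because the weights add up to 1. *)
- rewrite nL dL !scalerDr addrACA -scalerDl const_fun_halves scale1r.
  by rewrite !(vector_field_scaleCA f).
Qed.

Lemma metric_connection_midpoint g nabla D :
  metric_connection g nabla -> metric_connection g D ->
  metric_connection g (midpoint_connection nabla D).
Proof.
move=> [nC nG] [dC dG]; split; first exact: linear_connection_midpoint.
move=> X Y Z; pose c := const_fun M (1 / 2).
(* The covariant derivative of [g] is affine in the connection: the term X(g(Y, Z)) is shared, and
   its two halves restore it. *)
transitivity (c * nabla_tensor02 nabla g X Y Z + c * nabla_tensor02 D g X Y Z);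
  last by rewrite nG dG !mulr0 addr0.
rewrite /nabla_tensor02 /midpoint_connection !tensor02Dl !tensor02Dr.
rewrite !tensor02Zl !tensor02Zr; apply: smooth_funP => p.
rewrite !(smooth_funD, smooth_funN, smooth_funM) const_funE; by field.
Qed.

End Midpoint.

Section Involution.
Context {R : realType} {n : nat} {M : manifold R n}.
Context {J : tensor11 M} {alpha : R}.
Hypothesis alpha2 : alpha * alpha = 1.
Hypothesis JJ : forall X, J (J X) = const_fun M alpha *: X.
Implicit Types (X Y Z : vector_field M).
Implicit Types (nabla : vector_field M -> vector_field M -> vector_field M).

(** As [alpha] squares to 1, [alpha J] is the inverse of [J]; hence [J_star] is conjugation of the
    connection by [J]. *)
Lemma tensor11_inv X : const_fun M alpha *: J (J X) = X.
Proof. by rewrite JJ scalerA -const_funM alpha2 const_fun1 scale1r. Qed.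

Lemma linear_connection_J_star nabla :
  linear_connection nabla -> linear_connection (J_star alpha J nabla).
Proof.
move=> [nDl nZl nDr nZr nL].
rewrite /J_star; split=> [X X' Y|f X Y|X Y Y'|a X Y|f X Y].
- by rewrite nDl tensor11D scalerDr.
- by rewrite nZl tensor11Z vector_field_scaleCA.
- by rewrite tensor11D nDr tensor11D scalerDr.
- by rewrite tensor11Z nZr tensor11Z vector_field_scaleCA.
(* The derivative term becomes alpha J(X(f) J Y) = X(f) Y, which is the Leibniz term required. *)
- rewrite tensor11Z nL tensor11D !tensor11Z scalerDr.
  by rewrite !(vector_field_scaleCA (const_fun M alpha)) tensor11_inv.
Qed.

Context {g : tensor02 M} {epsilon : R}.
Hypothesis epsilon2 : epsilon * epsilon = 1.
Hypothesis gJ : forall X Y, g (J X) (J Y) = epsilon *: g X Y.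

(** Both sides equal alpha g(J X, Y): on the right, the isometry property applies [J] to both
    arguments and J(J Y) = alpha Y. *)
Lemma tensor02_adjl X Y :
  g (const_fun M alpha *: J X) Y = epsilon *: g X (J Y).
Proof. by rewrite -gJ JJ tensor02Zl tensor02Zr. Qed.

Lemma tensor02_adjr X Y :
  g X (const_fun M alpha *: J Y) = epsilon *: g (J X) Y.
Proof. by rewrite -gJ JJ tensor02Zl tensor02Zr. Qed.

Lemma metric_connection_J_star nabla :
  metric_connection g nabla -> metric_connection g (J_star alpha J nabla).
Proof.
move=> [nC nG]; split; first exact: linear_connection_J_star.
move=> X Y Z.
transitivity (epsilon *: nabla_tensor02 nabla g X (J Y) (J Z));
  last by rewrite nG scaler0.
(* The adjoint rules match the two connection terms; in the derivative term, [gJ] yields a second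
   [epsilon], which cancels the first. *)
rewrite /nabla_tensor02 /J_star tensor02_adjl tensor02_adjr gJ field_derZ.
by rewrite !scalerBr scalerA epsilon2 scale1r.
Qed.

End Involution.

Theorem proposition4p3 (R : realType) (n : nat) (M : manifold R n)
    (J : tensor11 M) (g : tensor02 M) (alpha epsilon : R)
    (nabla : vector_field M -> vector_field M -> vector_field M) :
  J2pm1_metric_manifold J g alpha epsilon ->
  metric_connection g nabla ->
  metric_connection g (pi_connection alpha J nabla) /\
  (forall X Y : vector_field M,
     pi_connection alpha J nabla X Y =
     const_fun M (1 / 2) *: nabla X Y +
     const_fun M (alpha / 2) *: J (nabla X (J Y))).
Proof.
move=> [[alpha1 epsilon1] _ JJ _ gJ] nG.
have sq1 (s : R) : s = 1 \/ s = -1 -> s * s = 1.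
  by move=> [] ->; rewrite ?mulrNN mulr1.
split.
  apply: metric_connection_midpoint => //.
  by apply: (metric_connection_J_star _ JJ _ gJ) => //; exact: sq1.
move=> X Y; have -> : alpha / 2 = 1 / 2 * alpha by field.
by rewrite /pi_connection /J_star scalerA -const_funM.
Qed.
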